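(* For each positive integer $k$ there exist unique positive integers $d,r$ with $d$ square-free such that $\eta=\frac{k}{2}+\frac{r}{2}\sqrt{d}$ is a unit of (the ring of integers of) the quadratic field $\mathbb{Q}(\sqrt{d})$ with norm $N(\eta)=\left(\frac{k}{2}\right)^2-\left(\frac{r}{2}\right)^2d=-1$. Moreover, for these $d,r$, the $k$-Fibonacci sequence coincides with the Fibonacci sequence of degree $d$ with respect to the unit $\eta$, i.e. with $(F_{\eta,n})_{n\ge1}$.
   Context: For a positive integer $k$, the $k$-Fibonacci sequence is the sequence $(G_n)_{n\ge1}$ with $G_1=1$, $G_2=k$ and $G_{n+2}=kG_{n+1}+G_n$ for all $n\ge1$. For a unit $\eta=\alpha+\beta\sqrt d$ of $\mathbb{Q}(\sqrt d)$ with $\alpha,\beta\in\mathbb{Q}$, $\beta\neq0$, write $\eta^n=\alpha_n+\beta_n\sqrt d$ ($\alpha_n,\beta_n\in\mathbb{Q}$) for $n\ge1$; the Fibonacci sequence of degree $d$ with respect to $\eta$ is $F_{\eta,n}=\beta_n/\beta$, $n\ge1$. *)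

(* Defs.v *)
From mathcomp Require Import all_boot all_order all_algebra all_field.
From mathcomp Require Import boolp classical_sets.

Set Implicit Arguments.
Unset Strict Implicit.
Unset Printing Implicit Defensive.

Import Order.TTheory GRing.Theory Num.Theory.
Local Open Scope ring_scope.

Definition squarefree (d : nat) : Prop :=
  forall m : nat, (m ^ 2 %| d)%N -> m = 1%N.

(* The sequence is indexed from 1; the value at 0 is junk. *)
Fixpoint kfib (k n : nat) : nat :=
  match n with
  | 0 => 0
  | 1 => 1
  | 2 => k
  | (m.+1 as p).+1 => k * kfib k p + kfib k m
  end%N.

(* Elements of Q(sqrt d) are taken in the field algC of algebraic numbers. *)
Definition qelt (d : nat) (a b : rat) : algC :=
  ratr a + ratr b * sqrtC d%:R.

Definition in_qfield (d : nat) (x : algC) : Prop :=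
  exists a b : rat, x = qelt d a b.

(* [Q(sqrt d) : Q] = 2. *)
Definition is_quadratic (d : nat) : Prop := sqrtC d%:R \notin Crat.

Definition qinteger (d : nat) (x : algC) : Prop :=
  in_qfield d x /\ x \in Aint.

Definition qunit (d : nat) (x : algC) : Prop :=
  qinteger d x /\ exists y : algC, qinteger d y /\ x * y = 1.

(* Coordinates of x in the basis (1, sqrt d); unique when is_quadratic d
   (see qcoordE), and (0, 0) when x is not in Q(sqrt d). *)
Definition qcoord (d : nat) (x : algC) : rat * rat :=
  xget (0, 0) [set p : rat * rat | x = qelt d p.1 p.2]%classic.

Definition qconj (d : nat) (x : algC) : algC :=
  qelt d (qcoord d x).1 (- (qcoord d x).2).

Definition qnorm (d : nat) (x : algC) : algC := x * qconj d x.

Definition fib_deg (d : nat) (eta : algC) (n : nat) : rat :=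
  (qcoord d (eta ^+ n)).2 / (qcoord d eta).2.

Definition eta (k d r : nat) : algC := qelt d (k%:R / 2) (r%:R / 2).

Definition admissible (k d r : nat) : Prop :=
  [/\ (0 < d)%N, (0 < r)%N & squarefree d] /\
  [/\ is_quadratic d,
      qunit d (eta k d r),
      qnorm d (eta k d r) = (k%:R / 2) ^+ 2 - (r%:R / 2) ^+ 2 * d%:R
    & (k%:R / 2) ^+ 2 - (r%:R / 2) ^+ 2 * d%:R = -1 :> algC].

Lemma qcoordE (d : nat) (a b : rat) :
  is_quadratic d -> qcoord d (qelt d a b) = (a, b).
Proof.
move=> irr; rewrite /qcoord; case: xgetP => [[a' b'] _ /= E|/(_ (a, b))[] //].
have Es : ratr (b - b') * sqrtC d%:R = ratr (a' - a) :> algC.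
  move: E; rewrite /qelt !rmorphB /= mulrBl => E; apply/eqP.
  by rewrite subr_eq addrAC -E addrAC subrr add0r.
have [eb|nb] := eqVneq (b - b') 0.
  move: Es; rewrite eb rmorph0 mul0r => /esym/eqP; rewrite fmorph_eq0 subr_eq0.
  by move=> /eqP->; move/eqP: eb; rewrite subr_eq0 => /eqP->.
case/negP: irr.
have -> : sqrtC d%:R = ratr ((a' - a) / (b - b')) :> algC.
  by rewrite fmorph_div /= -Es mulrAC divff ?mul1r // fmorph_eq0.
exact: Crat_rat.
Qed.

(* Main.v *)
(* The norm condition reads r^2 d = k^2 + 4, and every positive integer is
   uniquely a square times a square-free number.  Since k^2 + 4 is not a square
   for k > 0, sqrt d is irrational.  The unit satisfies eta^2 = k eta + 1, so
   eta^n = G_n eta + G_(n-1) by induction, and comparing coefficients of sqrt d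
   gives the second claim. *)
Require Import Defs.
From mathcomp Require Import all_boot all_order all_algebra all_field.
From mathcomp Require Import ring zify.

Import Order.TTheory GRing.Theory Num.Theory.
Local Open Scope ring_scope.

(** Take the largest [r] with [r ^ 2] dividing [N]: a square [m ^ 2] dividing the quotient [d] would
    make [m * r] another candidate, so maximality forces [m = 1]. *)
Lemma squarefree_part_exists (N : nat) : (0 < N)%N ->
  exists d r : nat,
    [/\ (0 < d)%N, (0 < r)%N, squarefree d & (r ^ 2 * d = N)%N].
Proof.
move=> N_gt0; pose P r := (0 < r)%N && (r ^ 2 %| N)%N.
have exP : exists r, P r by exists 1%N; rewrite /P exp1n dvd1n.
have ubP r : P r -> (r <= N)%N.
  by case/andP=> r_gt0 /(dvdn_leq N_gt0); apply: leq_trans; rewrite leq_pmulr.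
have [r /andP[r_gt0 /dvdnP[d defN]] maxr] := ex_maxnP exP ubP.
have d_gt0 : (0 < d)%N by move: N_gt0; rewrite defN muln_gt0 => /andP[].
exists d, r; split=> //; last by rewrite mulnC -defN.
move=> m md; have m_gt0 : (0 < m)%N.
  by case: m md => //; rewrite exp0n // dvd0n => /eqP d0; rewrite d0 in d_gt0.
have /maxr : P (m * r)%N.
  by rewrite /P muln_gt0 m_gt0 r_gt0 expnMn defN dvdn_mul.
by rewrite -[leqRHS]mul1n leq_pmul2r //; lia.
Qed.

(** Cancelling the gcd of [r] and [r'] leaves [a ^ 2 * d = b ^ 2 * d'] with [a], [b] coprime. By
    Gauss [a ^ 2] divides [d'] and [b ^ 2] divides [d], so both are 1. *)
Lemma squarefree_part_unique (d r d' r' : nat) :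
    (0 < r)%N -> (0 < r')%N -> squarefree d -> squarefree d' ->
  (r ^ 2 * d = r' ^ 2 * d')%N -> d = d' /\ r = r'.
Proof.
move=> r_gt0 r'_gt0 sqd sqd'; set g := gcdn r r'.
have g_gt0 : (0 < g)%N by rewrite gcdn_gt0 r_gt0.
have [a defr] := dvdnP (dvdn_gcdl r r' : (g %| r)%N).
have [b defr'] := dvdnP (dvdn_gcdr r r' : (g %| r')%N).
have co_ab : coprime a b.
  by rewrite /coprime -(eqn_pmul2r g_gt0) muln_gcdl -defr -defr' mul1n.
move=> Er; have E : (a ^ 2 * d = b ^ 2 * d')%N.
  apply/eqP; rewrite -(@eqn_pmul2l (g ^ 2)%N) ?expn_gt0 ?g_gt0 //.
  by rewrite (mulnA _ _ d) (mulnA _ _ d') -!expnMn ![(g * _)%N]mulnC -defr -defr' Er.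
have a1 : a = 1%N.
  apply: sqd'; rewrite -(@Gauss_dvdr _ (b ^ 2)%N) ?coprimeXl ?coprimeXr //.
  by rewrite -E dvdn_mulr.
have b1 : b = 1%N.
  apply: sqd; rewrite -(@Gauss_dvdr _ (a ^ 2)%N).
    by rewrite E dvdn_mulr.
  by rewrite coprimeXl ?coprimeXr // coprime_sym.
by move: E; rewrite defr defr' a1 b1 !mul1n.
Qed.

(** The root [s] would exceed [k]. The case [s = k + 1] needs [2 * k + 1 = 4], which parity forbids,
    and [(k + 2) ^ 2] is already too large. *)
Lemma sqrn_neq_addn4 (k s : nat) : (0 < k)%N -> (s ^ 2 <> k ^ 2 + 4)%N.
Proof.
move=> k_gt0 E; have lt_ks : (k < s)%N by nia.
have [eq_s|ne_s] := eqVneq s k.+1; first by nia.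
have : (k.+2 <= s)%N by lia.
by nia.
Qed.

(** As a root of the monic polynomial [X ^ 2 - m], [x] is an algebraic integer, and a rational
    algebraic integer is an integer. *)
Lemma rational_sqrt_nat (m : nat) (x : algC) :
  x \in Crat -> x ^+ 2 = m%:R -> exists s : nat, (s ^ 2 = m)%N.
Proof.
move=> xQ Ex.
have xA : x \in Aint.
  apply: (@root_monic_Aint ('X^2 - m%:R%:P)).
  - by rewrite rootE !hornerE Ex subrr.
  - by rewrite monicXnsubC.
  - apply/polyOverP => i; rewrite coefB coefXn coefC /=.
    by rewrite rpredB ?rpred_nat //; case: eqP; rewrite ?rpred_nat ?rpred0.
have /intrP[z Ez] := Cint_rat_Aint xQ xA.
(* [x] may be the negative root, hence the absolute value. *)
exists `|z|%N; apply/eqP; rewrite -(eqr_nat algC) natrX natr_absz intr_norm.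
by rewrite -Ez -Ex real_normK // Ez realz.
Qed.

Section QuadraticUnit.
Variables (k d r : nat).
Hypothesis k_gt0 : (0 < k)%N.
Hypothesis rdE : (r ^ 2 * d = k ^ 2 + 4)%N.

Let rdC : r%:R ^+ 2 * d%:R = k%:R ^+ 2 + 4 :> algC.
Proof. by rewrite -!natrX -natrM rdE natrD. Qed.

Lemma etaE : eta k d r = k%:R / 2 + r%:R / 2 * sqrtC d%:R.
Proof. by rewrite /eta /qelt !fmorph_div !rmorph_nat. Qed.

Lemma eta_sqr : eta k d r ^+ 2 = k%:R * eta k d r + 1.
Proof.
rewrite etaE; set s := sqrtC _.
have Es : s ^+ 2 = d%:R by rewrite sqrtCK.
(* The remainder is isolated as a quarter of [r ^ 2 * d - k ^ 2], which [rdC] evaluates to 1. *)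
have -> : (k%:R / 2 + r%:R / 2 * s) ^+ 2 =
  k%:R * (k%:R / 2 + r%:R / 2 * s) + (r%:R ^+ 2 * s ^+ 2 - k%:R ^+ 2) / 4.
  by field.
by rewrite Es rdC; field.
Qed.

Lemma eta_quadratic : is_quadratic d.
Proof.
apply/negP => sQ.
(* If [sqrtC d] were rational, so would be [r * sqrtC d], a square root of [k ^ 2 + 4]. *)
have [||s] := @rational_sqrt_nat (k ^ 2 + 4) (r%:R * sqrtC d%:R).
- by rewrite rpredM ?rpred_nat.
- by rewrite exprMn sqrtCK -rdE natrM natrX.
- exact: sqrn_neq_addn4.
Qed.

Lemma eta_Aint : eta k d r \in Aint.
Proof.
apply: (@root_monic_Aint ('X^2 - (k%:R *: 'X + 1%:P))).
- by rewrite rootE !hornerE eta_sqr; apply/eqP; ring.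
- rewrite monicE lead_coefDl ?lead_coefXn // size_polyN size_polyXn.
  by rewrite (leq_ltn_trans (size_polyD _ _)) // gtn_max size_polyC oner_eq0
     (leq_ltn_trans (size_scale_leq _ _)) // size_polyX.
- apply/polyOverP => i; rewrite coefB coefXn coefD coefZ coefX coefC /=.
  by case: (i =P 0%N) => _; rewrite rpredB ?rpredD ?rpredM ?rpred_nat ?rpred0
     ?rpred1.
Qed.

Lemma eta_unit : qunit d (eta k d r).
Proof.
split; first by split; [exists (k%:R / 2), (r%:R / 2) | exact: eta_Aint].
(* The quadratic equation of [eta] reads [eta * (eta - k) = 1]; this inverse is minus the conjugate
   of [eta]. *)
exists (eta k d r - k%:R); split; last first.
  by rewrite mulrBr -expr2 eta_sqr; ring.
split; last by rewrite rpredB ?eta_Aint // rpred_nat.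
exists (- (k%:R / 2)), (r%:R / 2); rewrite etaE /qelt rmorphN !fmorph_div.
by rewrite !rmorph_nat; field.
Qed.

Lemma eta_norm :
  qnorm d (eta k d r) = (k%:R / 2) ^+ 2 - (r%:R / 2) ^+ 2 * d%:R.
Proof.
rewrite /qnorm /qconj {2 3}/eta !(qcoordE _ _ eta_quadratic) /= etaE.
rewrite /qelt rmorphN !fmorph_div !rmorph_nat; set s := sqrtC _.
have <- : s ^+ 2 = d%:R by rewrite sqrtCK.
by ring.
Qed.

Lemma eta_exp (n : nat) :
  eta k d r ^+ n.+1 = (kfib k n.+1)%:R * eta k d r + (kfib k n)%:R.
Proof.
(* The value [kfib k 0 = 0] matters here: it gives the base case and makes the recurrence hold from
   index 2 on. *)
elim: n => [|n IHn]; first by rewrite expr1 mul1r addr0.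
have -> : kfib k n.+2 = (k * kfib k n.+1 + kfib k n)%N.
  by case: n {IHn} => //=; rewrite muln1 addn0.
by rewrite exprSr IHn mulrDl -mulrA -expr2 eta_sqr natrD natrM; ring.
Qed.

Lemma fib_deg_eta (n : nat) : fib_deg d (eta k d r) n.+1 = (kfib k n.+1)%:R.
Proof.
have r_neq0 : r%:R != 0 :> rat by rewrite pnatr_eq0; nia.
(* Both elements are put in the form [qelt d _ _], so that [qcoordE] can read off their
   coordinates. *)
have -> : fib_deg d (eta k d r) n.+1 =
    (qcoord d (qelt d ((kfib k n.+1)%:R * (k%:R / 2) + (kfib k n)%:R)
                      ((kfib k n.+1)%:R * (r%:R / 2)))).2
      / (qcoord d (qelt d (k%:R / 2) (r%:R / 2))).2.
  rewrite /fib_deg eta_exp; congr ((qcoord d _).2 / _).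
  by rewrite etaE /qelt rmorphD !rmorphM !fmorphV !rmorph_nat; ring.
by rewrite !(qcoordE _ _ eta_quadratic) /= mulfK // mulf_neq0.
Qed.

End QuadraticUnit.

Lemma norm_eqN1 (k d r : nat) :
  (k%:R / 2) ^+ 2 - (r%:R / 2) ^+ 2 * d%:R = -1 :> algC <->
  (r ^ 2 * d = k ^ 2 + 4)%N.
Proof.
split=> [E | E].
  apply/eqP; rewrite -(eqr_nat algC) natrM natrD !natrX -subr_eq0.
  have -> : r%:R ^+ 2 * d%:R - (k%:R ^+ 2 + 4) =
    -4 * ((k%:R / 2) ^+ 2 - (r%:R / 2) ^+ 2 * d%:R + 1) :> algC by field.
  by rewrite E addNr mulr0.
have EC : r%:R ^+ 2 * d%:R = k%:R ^+ 2 + 4 :> algC.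
  by rewrite -!natrX -natrM E natrD.
have -> : (k%:R / 2) ^+ 2 - (r%:R / 2) ^+ 2 * d%:R =
  (k%:R ^+ 2 - r%:R ^+ 2 * d%:R) / 4 :> algC by field.
by rewrite EC; field.
Qed.

(** The single equation [r ^ 2 * d = k ^ 2 + 4] yields irrationality, the unit property and the
    norm, which turns existence and uniqueness into the square-free decomposition of [k ^ 2 + 4]. *)
Lemma admissibleE (k d r : nat) : (0 < k)%N ->
  admissible k d r <->
  [/\ (0 < d)%N, (0 < r)%N, squarefree d & (r ^ 2 * d = k ^ 2 + 4)%N].
Proof.
move=> k_gt0; split=> [[[d0 r0 sqd] [_ _ _ /norm_eqN1]] // | [d0 r0 sqd E]].
split=> //; split; last exact/norm_eqN1.
- exact: eta_quadratic E.
- exact: eta_unit E.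
- exact: eta_norm E.
Qed.

Theorem theorem28 (k : nat) (hk : (0 < k)%N) :
  (exists! dr : nat * nat, admissible k dr.1 dr.2) /\
  (forall d r : nat, admissible k d r ->
     forall n : nat, (1 <= n)%N -> (kfib k n)%:R = fib_deg d (eta k d r) n :> rat).
Proof.
split=> [|d r /(admissibleE _ _ _ hk)[_ _ _ E] [//|n] _].
  have [|d [r dr]] := @squarefree_part_exists (k ^ 2 + 4); first by rewrite addn4.
  exists (d, r); split=> [|[d' r']] /=; first exact/admissibleE.
  case/(admissibleE _ _ _ hk)=> _ r'0 sqd' E'; case: dr => _ r0 sqd E.
  by have [-> ->] := squarefree_part_unique _ _ _ _ r0 r'0 sqd sqd'
    (etrans E (esym E')).
by rewrite (fib_deg_eta _ _ _ hk E).
Qed.
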